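(* Let $M,M'$ be two $\mathbb{O}$-bimodules. Then $\operatorname{Hom}_{\mathcal{LO}}(M,M')$ admits a canonical $\mathbb{O}$-bimodule structure, namely the one given, for $f\in\operatorname{Hom}_{\mathcal{LO}}(M,M')$, $r\in\mathbb{O}$, $x\in M$, by the scalar multiplications $$(f\odot r)(x)=f(x)r-A_r(x,f),\qquad(r\odot f)(x)=f(xr)+A_r(x,f).$$
   Context: $\mathbb{O}$ is the real algebra of octonions with standard basis $e_0=1,e_1,\dots,e_7$. A left $\mathbb{O}$-module is a real vector space $M$ with an $\mathbb{R}$-bilinear unital multiplication $\mathbb{O}\times M\to M$ with $r(rm)=r^2m$ for all $r\in\mathbb{O}$, $m\in M$. Put $[p,q,m]=(pq)m-p(qm)$. An $\mathbb{O}$-bimodule is a left $\mathbb{O}$-module with an $\mathbb{R}$-bilinear unital right multiplication such that $[p,q,m]=[m,p,q]=[q,m,p]$ for all $p,q,m$, where $[m,p,q]=(mp)q-m(pq)$, $[q,m,p]=(qm)p-q(mp)$. For an $\mathbb{O}$-bimodule $M$ let $\mathscr{A}(M)=\{m:[p,q,m]=0\ \forall p,q\}$; one has $M=\bigoplus_{i=0}^7e_i\mathscr{A}(M)$, and $\operatorname{Re}:M\to\mathscr{A}(M)$ is the projection $\sum_ie_ix_i\mapsto x_0$. For an $\mathbb{R}$-linear map $f:M\to M'$ put $A_p(x,f)=f(px)-pf(x)$. $\operatorname{Hom}_{\mathcal{LO}}(M,M')$ is the set of left para-linear maps: $\mathbb{R}$-linear $f$ with $\operatorname{Re}A_p(x,f)=0$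 for all $p\in\mathbb{O}$, $x\in M$. *)

(* Defs.v *)
From HB Require Import structures.
From mathcomp Require Import all_boot all_order all_algebra.
From mathcomp Require Import boolp classical_sets functions reals.

Set Implicit Arguments.
Unset Strict Implicit.
Unset Printing Implicit Defensive.

Import GRing.Theory.
Local Open Scope ring_scope.

(* MathComp rings are associative, so the octonions are the real vector space
   R^8 with a product given by structure constants. *)
Notation octonion R := 'rV[R]_8.

Section Octonions.
Variable R : realType.
Local Notation O := (octonion R).

(* The oriented lines of the Fano plane: (i, j, k) with e_i e_j = e_k. *)
Definition fano : seq (nat * nat * nat) :=
  [:: (1, 2, 3); (1, 4, 5); (1, 7, 6); (2, 4, 6); (2, 5, 7); (3, 4, 7);
      (3, 6, 5)]%N.

Definition fano_cyclic : seq (nat * nat * nat) :=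
  fano ++ [seq (t.1.2, t.2, t.1.1) | t <- fano]
       ++ [seq (t.2, t.1.1, t.1.2) | t <- fano].

Definition oct_eps (i j k : nat) : R :=
  if (i, j, k) \in fano_cyclic then 1
  else if (j, i, k) \in fano_cyclic then -1
  else 0.

(* The coefficient of e_k in e_i e_j: e_0 is the unit, and
   e_i e_j = - delta_ij + sum_k eps_ijk e_k for i, j > 0. *)
Definition oct_coef (i j k : nat) : R :=
  if i == 0%N then (j == k)%:R
  else if j == 0%N then (i == k)%:R
  else if k == 0%N then - (i == j)%:R
  else oct_eps i j k.

Definition oct_mul (p q : O) : O :=
  \row_(k < 8) \sum_(i < 8) \sum_(j < 8) oct_coef i j k * p 0 i * q 0 j.

Definition oct_basis (i : 'I_8) : O := delta_mx 0 i.

Definition oct_one : O := oct_basis ord0.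

End Octonions.

Section Bimodules.
Variable R : realType.
Local Notation O := (octonion R).

Record is_left_omodule (M : lmodType R) (lact : O -> M -> M) : Prop := {
  lact_linear_l : forall m, linear (lact ^~ m);
  lact_linear_r : forall p, linear (lact p);
  lact1 : forall m, lact (oct_one R) m = m;
  lact_alt : forall r m, lact r (lact r m) = lact (oct_mul r r) m
}.

(* [p, q, m], [m, p, q] and [q, m, p] *)
Definition assoc_l (M : lmodType R) (lact : O -> M -> M) p q m : M :=
  lact (oct_mul p q) m - lact p (lact q m).
Definition assoc_r (M : lmodType R) (ract : M -> O -> M) m p q : M :=
  ract (ract m p) q - ract m (oct_mul p q).
Definition assoc_m (M : lmodType R) (lact : O -> M -> M) (ract : M -> O -> M)
  q m p : M := ract (lact q m) p - lact q (ract m p).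

Record is_obimodule (M : lmodType R) (lact : O -> M -> M) (ract : M -> O -> M)
    : Prop := {
  obimod_left : is_left_omodule lact;
  ract_linear_l : forall p, linear (ract ^~ p);
  ract_linear_r : forall m, linear (ract m);
  ract1 : forall m, ract m (oct_one R) = m;
  assoc_lr : forall p q m, assoc_l lact p q m = assoc_r ract m p q;
  assoc_rm : forall p q m, assoc_r ract m p q = assoc_m lact ract q m p
}.

Record obimodule := OBimodule {
  obimod_sort :> lmodType R;
  lmul : O -> obimod_sort -> obimod_sort;
  rmul : obimod_sort -> O -> obimod_sort;
  obimoduleP : is_obimodule lmul rmul
}.

End Bimodules.

Section ParaLinear.
Variable R : realType.
Local Notation O := (octonion R).
Implicit Types M N : obimodule R.

Definition associative_elt M (m : M) : Prop :=
  forall p q : O, assoc_l (@lmul R M) p q m = 0.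

(* The projection sum_i e_i x_i |-> x_0 for the decomposition of M as the direct
   sum of the e_i A(M).  That decomposition is a theorem about bimodules; the
   default value 0 would only be used on an element having no decomposition. *)
Definition Re M (m : M) : M :=
  xget 0 [set x0 | exists x : 'I_8 -> M,
    [/\ forall i, associative_elt (x i),
        m = \sum_(i < 8) lmul (oct_basis R i) (x i) & x0 = x ord0]].

(* A_p(x, f) *)
Definition defect M N (p : O) (x : M) (f : M -> N) : N :=
  f (lmul p x) - lmul p (f x).

Definition left_paralinear M N (f : M -> N) : Prop :=
  linear f /\ forall (p : O) (x : M), Re (defect p x f) = 0.

Definition homLO M N : {pred M -> N} := [pred f | `[< left_paralinear f >]].
Arguments homLO M N : clear implicits.

(* Hom_LO(M, N) as a type.  Its real vector space structure is the pointwise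
   one; hS records that the left para-linear maps are a subspace of M -> N. *)
Record HomLO M N (hS : submod_closed (homLO M N)) := MkHomLO {
  homLO_fun :> M -> N;
  homLO_funP : homLO_fun \in homLO M N
}.

End ParaLinear.

Arguments homLO {R} M N.

Section HomLOLmodule.
Variables (R : realType) (M N : obimodule R).
Variable hS : submod_closed (homLO M N).

HB.instance Definition _ := [isSub for @homLO_fun R M N hS].
HB.instance Definition _ := [Choice of HomLO hS by <:].
HB.instance Definition _ := GRing.SubChoice_isSubLmodule.Build R (M -> N)
  (homLO M N) (HomLO hS) (GRing.submod_closed_semi hS).

End HomLOLmodule.

(* Main.v *)
Require Import Defs.
From HB Require Import structures.
From mathcomp Require Import all_boot all_order all_algebra.
From mathcomp Require Import boolp classical_sets functions reals.
Local Open Scope ring_scope.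
Import GRing.Theory Num.Theory.

(** Everything rests on the structure of a single bimodule N: the map Re is
    defined on all of N, is linear, and behaves like the real part of an
    octonion, namely
    - Re vanishes on associators ([re_assoc]) and Re (x p) = Re (p x)
      ([re_mulC]);
    - x is determined by the values Re (p x) ([re_lmul_eq0]).

    Granted this, the theorem is formal. Para-linearity of f says that
    Re (p f(x)) = Re f(p x), so f is recovered from g = Re o f, and, since defects
    have zero real part, the two products become Re ((f.r)(x)) = g(r x) and
    Re ((r.f)(x)) = g(x r). Hence the right action of r on f is the
    transpose of the left action of r on M, and the left action is the
    transpose of the right one. Stability of Hom_LO and each bimodule axiom
    for Hom_LO thereby turn into bimodule identities of M evaluated under g.

    To build Re, write L_i for the left multiplication by e_i. The L_i with
    i > 0 anticommute and square to -1. For a line (a, b, c) of the Fano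
    plane, with e_a e_b = e_c, put T = - L_a L_b L_c. These seven operators
    are commuting involutions, T commutes with L_n if n is on the line and
    anticommutes with it otherwise, and associative elements are exactly the
    common fixed points of the T's. So Re should be the projection onto
    these common fixed points.

    The left module structure alone does not suffice: on the conjugate
    module, where p acts as multiplication by its conjugate, the T's have no
    common fixed point. What rules this out is the right multiplication R by
    e_a. The equality of the left and middle associators computes the
    conjugate of R by L_b in terms of L_a and T, and comparing the squares
    of R and of this conjugate gives (R + L_a) T = R + L_a for every line
    through a ([sym_op_line]). Conjugating this relation for a second line,
    with operator T', by L_b gives 2 (R + L_a) = L_a (1 + T)(1 + T')
    ([sym_opE]). Using the three lines through a, this forces the product of
    two of the corresponding T's to be the third ([concurrent_lines]). Thus
    1 and the T's form an elementary abelian group of order 8, generated by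
    the lines 123, 145, 246, and averaging over it is the projection sought.
    Conjugation by the eight L_i realises each of the eight sign changes of
    the generators once, so the corresponding eight projections sum to the
    identity, which is the decomposition of N as the sum of the e_i A(N)
    ([re_decomposition]). Finally [sym_opE] under Re reads 2 Re (x e_a + e_a
    x) = 4 Re (e_a x). *)

(** * Octonions in coordinates *)

Section OctonionTable.
Set Implicit Arguments.
Unset Strict Implicit.
Unset Printing Implicit Defensive.
Variable R : realType.
Local Notation O := (octonion R).

(** The basis indexed by [nat], so that it can be applied to the entries of
    the triples of [fano_cyclic]. *)
Definition unit_oct (n : nat) : O := \row_k (k == n :> nat)%:R.
Local Notation e := unit_oct.

Lemma oct_basisE (i : 'I_8) : oct_basis R i = e i.
Proof. by apply/rowP=> k; rewrite !mxE eqxx. Qed.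

Lemma oct_oneE : oct_one R = e 0.
Proof. exact: oct_basisE. Qed.

Lemma oct_sum (p : O) : p = \sum_(i < 8) p 0 i *: e i.
Proof.
rewrite {1}[p]row_sum_delta; apply: eq_bigr => i _.
by rewrite -oct_basisE.
Qed.

Lemma oct_mul_linearl q : linear (fun p : O => oct_mul p q).
Proof.
move=> a p1 p2; apply/rowP=> k; rewrite !mxE mulr_sumr -big_split /=.
apply: eq_bigr => i _; rewrite mulr_sumr -big_split /=; apply: eq_bigr => j _.
by rewrite !mxE mulrDr mulrDl -!mulrA; congr (_ + _); rewrite mulrCA.
Qed.

Lemma oct_mul_linearr (p : O) : linear (oct_mul p).
Proof.
move=> a q1 q2; apply/rowP=> k; rewrite !mxE mulr_sumr -big_split /=.
apply: eq_bigr => i _; rewrite mulr_sumr -big_split /=; apply: eq_bigr => j _.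
by rewrite !mxE mulrDr; congr (_ + _); rewrite mulrCA.
Qed.

Lemma unit_octM i j : (i < 8)%N -> (j < 8)%N ->
  oct_mul (e i) (e j) = \row_k oct_coef R i j k.
Proof.
move=> hi hj; apply/rowP=> k; rewrite !mxE (bigD1 (Ordinal hi)) //=.
rewrite (bigD1 (Ordinal hj)) //= !mxE !eqxx !mulr1 !big1 ?addr0 //.
  move=> i'; rewrite -val_eqE /= => /negPf ni.
  by apply: big1 => j' _; rewrite !mxE ni mulr0 mul0r.
by move=> j'; rewrite -val_eqE /= => /negPf nj; rewrite !mxE nj mulr0.
Qed.

Lemma unit_oct1M j : (j < 8)%N -> oct_mul (e 0) (e j) = e j.
Proof.
move=> hj; rewrite unit_octM //; apply/rowP=> k.
by rewrite !mxE /oct_coef /= [j == _]eq_sym.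
Qed.

Lemma unit_octM1 j : (j < 8)%N -> oct_mul (e j) (e 0) = e j.
Proof.
move=> hj; rewrite unit_octM //; apply/rowP=> k; rewrite !mxE /oct_coef /=.
by rewrite [val k == _]eq_sym; case: (j =P 0%N) => [->|].
Qed.

Lemma unit_octMM i : (0 < i < 8)%N -> oct_mul (e i) (e i) = - e 0.
Proof.
case/andP=> i0 hi; rewrite unit_octM //; apply/rowP=> k; rewrite !mxE.
rewrite /oct_coef eqn0Ngt i0 /= eqxx; case: eqP => // k0; rewrite oppr0.
have /allP/(_ i) : all (fun i => all (fun k => (i, i, k) \notin fano_cyclic)
  (iota 0 8)) (iota 1 7) by [].
rewrite mem_iota i0 => /(_ hi)/allP/(_ k).
by rewrite mem_iota ltn_ord /oct_eps => /(_ isT) /negPf->.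
Qed.

(** What the later proofs use about a triple of [fano_cyclic], in a form
    that is checked by evaluation on the 21 triples. *)
Definition fano_spec (t : nat * nat * nat) :=
  let: (i, j, k) := t in
  [&& (0 < i < 8)%N, (0 < j < 8)%N, (0 < k < 8)%N, uniq [:: i; j; k],
      (j, k, i) \in fano_cyclic &
      all (fun k' => (((i, j, k') \in fano_cyclic) == (k' == k)) &&
                     ((j, i, k') \notin fano_cyclic)) (iota 0 8)].

Lemma fano_cyclicP t : t \in fano_cyclic -> fano_spec t.
Proof. by move: t; apply/allP. Qed.

Lemma fano_rot a b c : (a, b, c) \in fano_cyclic -> (b, c, a) \in fano_cyclic.
Proof. by move/fano_cyclicP/and5P => [_ _ _ _ /andP[]]. Qed.

Lemma fano_mul a b c : (a, b, c) \in fano_cyclic ->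
  oct_mul (e a) (e b) = e c /\ oct_mul (e b) (e a) = - e c.
Proof.
move=> /fano_cyclicP/and5P[/andP[a0 a8] /andP[b0 b8] /andP[c0 c8]].
move=> /andP[+ _] /andP[_ /allP h]; rewrite inE negb_or => /andP[/negPf ab _].
move: (a0) (b0) (c0); rewrite !lt0n => /negPf na /negPf nb /negPf nc.
by split; rewrite unit_octM //; apply/rowP=> k; rewrite !mxE /oct_coef;
  rewrite na nb /= /oct_eps ?[b == a]eq_sym ab;
  (have /h/andP[/eqP-> /negPf->] : val k \in iota 0 8
    by rewrite mem_iota ltn_ord);
  case: (eqVneq (val k) 0%N) => [->|_] /=;
  rewrite ?[0%N == c]eq_sym ?nc ?oppr0 //;
  case: eqP; rewrite ?oppr0.
Qed.

Lemma fano_total i j : (0 < i < 8)%N -> (0 < j < 8)%N -> i != j ->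
  exists k, (i, j, k) \in fano_cyclic \/ (j, i, k) \in fano_cyclic.
Proof.
move=> hi hj ij; have : has (fun k => ((i, j, k) \in fano_cyclic) ||
   ((j, i, k) \in fano_cyclic)) (iota 0 8); last first.
  by case/hasP=> k _ /orP; exists k.
have /allP/(_ i) : all (fun i => all (fun j => (i != j) ==>
  has (fun k => ((i, j, k) \in fano_cyclic) || ((j, i, k) \in fano_cyclic))
  (iota 0 8)) (iota 1 7)) (iota 1 7) by [].
by rewrite mem_iota => /(_ hi)/allP/(_ j); rewrite mem_iota => /(_ hj)/implyP->.
Qed.

Lemma oct_ext (V : lmodType R) (f g : O -> V) :
  linear f -> linear g ->
  (forall i, (i < 8)%N -> f (e i) = g (e i)) -> f =1 g.
Proof.
move=> lf lg fg p; rewrite [p]oct_sum.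
pose f' : {linear O -> V} :=
  HB.pack f (GRing.isLinear.Build _ _ _ _ f lf).
pose g' : {linear O -> V} :=
  HB.pack g (GRing.isLinear.Build _ _ _ _ g lg).
rewrite -[f]/(f' : _ -> _) -[g]/(g' : _ -> _) !linear_sum.
by apply: eq_bigr => i _; rewrite !linearZ /= fg.
Qed.

Lemma oct_ext2 (V : lmodType R) (f g : O -> O -> V) :
    (forall q, linear (f ^~ q)) -> (forall p, linear (f p)) ->
    (forall q, linear (g ^~ q)) -> (forall p, linear (g p)) ->
    (forall i j, (i < 8)%N -> (j < 8)%N -> f (e i) (e j) = g (e i) (e j)) ->
  forall p q, f p q = g p q.
Proof.
move=> f1 f2 g1 g2 fg p q; apply: (oct_ext (f1 q) (g1 q)) => i hi.
by apply: (oct_ext (f2 _) (g2 _)) => j hj; apply: fg.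
Qed.

End OctonionTable.

(** * Linear identities in abelian groups *)

(** Identities between signed sums are decided by comparing the integer
    coefficients of each atom: [zmod] reifies both sides over a common list
    of atoms, and [zmod_from h] proves an equation that differs from [h] or
    its symmetric by such an identity. *)
Section AbelianGroupNormalisation.
Set Implicit Arguments.
Unset Strict Implicit.
Unset Printing Implicit Defensive.

Inductive zexpr :=
  ZVar of nat | ZZero | ZAdd of zexpr & zexpr | ZOpp of zexpr.

Fixpoint zcoef (u : zexpr) (n : nat) : int :=
  match u with
  | ZVar m => (m == n)%:R
  | ZZero => 0
  | ZAdd u v => zcoef u n + zcoef v n
  | ZOpp u => - zcoef u n
  end.

Fixpoint zeval (V : zmodType) (env : seq V) (u : zexpr) : V :=
  match u with
  | ZVar m => nth 0 env m
  | ZZero => 0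
  | ZAdd u v => zeval env u + zeval env v
  | ZOpp u => - zeval env u
  end.

Lemma zeval_sum (V : zmodType) (env : seq V) u :
  zeval env u = \sum_(i < size env) nth 0 env i *~ zcoef u i.
Proof.
elim: u => /= [m||u -> v ->|u ->].
- have [lt_m|le_m] := ltnP m (size env).
    rewrite (bigD1 (Ordinal lt_m)) //= eqxx mulr1z big1 ?addr0 // => i.
    by rewrite -val_eqE eq_sym /= => /negPf->.
  rewrite nth_default // big1 // => i _.
  by rewrite gtn_eqF // (leq_trans _ le_m).
- by rewrite big1.
- by rewrite -big_split; apply: eq_bigr => i _; rewrite mulrzDr.
- by rewrite -sumrN; apply: eq_bigr => i _; rewrite mulrNz.
Qed.

Lemma zeval_eq (V : zmodType) (env : seq V) u v :
  all (fun n => zcoef u n == zcoef v n) (iota 0 (size env)) ->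
  zeval env u = zeval env v.
Proof.
move=> /allP uv; rewrite !zeval_sum; apply: eq_bigr => i _.
by rewrite (eqP (uv i _)) // mem_iota ltn_ord.
Qed.

Lemma addrr_inj (R : numFieldType) (V : lmodType R) (x y : V) :
  x + x = y + y -> x = y.
Proof.
move=> h; have n2 : (2 : R) != 0 by rewrite pnatr_eq0.
by apply: (scalerI n2); rewrite !scaler_nat !mulr2n.
Qed.

End AbelianGroupNormalisation.

Ltac zatom x env :=
  lazymatch env with
  | context [cons x _] => env
  | _ => constr:(cons x env)
  end.
Ltac zindex x env :=
  lazymatch env with
  | cons x _ => constr:(0%N)
  | cons _ ?env' => let n := zindex x env' in constr:(S n)
  end.
Ltac zatoms u env :=
  lazymatch u with
  | GRing.add ?v ?w => let env := zatoms v env in zatoms w env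
  | GRing.opp ?v => zatoms v env
  | GRing.zero => env
  | _ => zatom u env
  end.
Ltac zreify u env :=
  lazymatch u with
  | GRing.add ?v ?w =>
      let a := zreify v env in let b := zreify w env in constr:(ZAdd a b)
  | GRing.opp ?v => let a := zreify v env in constr:(ZOpp a)
  | GRing.zero => constr:(ZZero)
  | _ => let n := zindex u env in constr:(ZVar n)
  end.
Ltac zmod :=
  lazymatch goal with
  | |- @eq ?V ?u ?v =>
    let env := zatoms u (@nil V) in
    let env := zatoms v env in
    let a := zreify u env in
    let b := zreify v env in
    exact: (@zeval_eq _ env a b isT)
  end.

Lemma zmod_cancel (V : zmodType) (x y x' y' : V) :
  x' = y' -> x - y = x' - y' -> x = y.
Proof. by move=> -> /eqP; rewrite subrr subr_eq0 => /eqP. Qed.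

Ltac zmod_from h :=
  first [apply: (zmod_cancel h); zmod | apply: (zmod_cancel (esym h)); zmod].

(** * Multiplications by basis elements *)

Section Clifford.
Set Implicit Arguments.
Unset Strict Implicit.
Unset Printing Implicit Defensive.
Variables (R : realType) (M : obimodule R).
Implicit Types (x y : M) (p q : octonion R).
Local Notation e := (unit_oct R).

Lemma lmul_linear p : linear (@lmul R M p).
Proof. exact: lact_linear_r (obimod_left (obimoduleP M)) p. Qed.
HB.instance Definition _ p := GRing.isLinear.Build R M M *:%R (@lmul R M p)
  (lmul_linear p).

Lemma lmulD p x y : lmul p (x + y) = lmul p x + lmul p y.
Proof. exact: linearD. Qed.

Lemma lmulN p x : lmul p (- x) = - lmul p x.
Proof. exact: linearN. Qed.

Lemma lmul_linearl x : linear (fun p => lmul p x).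
Proof. exact: lact_linear_l (obimod_left (obimoduleP M)) x. Qed.

Lemma rmul_linear p : linear (fun x : M => rmul x p).
Proof. exact: ract_linear_l (obimoduleP M) p. Qed.

Lemma rmul_linearr x : linear (rmul x).
Proof. exact: ract_linear_r (obimoduleP M) x. Qed.

Lemma lmulDl p q x : lmul (p + q) x = lmul p x + lmul q x.
Proof. by have := lmul_linearl x 1 p q; rewrite !scale1r. Qed.

Lemma lmulNl p x : lmul (- p) x = - lmul p x.
Proof.
have := lmul_linearl x (-1) p 0; have := lmulDl 0 0 x.
by rewrite addr0 -{1}[lmul 0 x]addr0 => /addrI<-; rewrite addr0 !scaleN1r addr0.
Qed.

(** Polarisation of the alternative law r (r x) = (r r) x. *)
Lemma lmul_anti p q x :
  lmul p (lmul q x) + lmul q (lmul p x) = lmul (oct_mul p q + oct_mul q p) x.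
Proof.
have alt r := lact_alt (obimod_left (obimoduleP M)) r x.
have := alt (p + q); rewrite !lmulDl !linearD /= !alt.
have -> : oct_mul (p + q) (p + q) =
    oct_mul p p + (oct_mul p q + oct_mul q p + oct_mul q q).
  have := oct_mul_linearl (p + q) 1 p q; rewrite !scale1r => ->.
  have := oct_mul_linearr p 1 p q; rewrite !scale1r => ->.
  have := oct_mul_linearr q 1 p q; rewrite !scale1r => ->.
  by rewrite !addrA.
by rewrite !lmulDl -!addrA => /addrI; rewrite !addrA => /addIr.
Qed.

Definition lop i x : M := lmul (e i) x.
Definition rop i x : M := rmul x (e i).
Local Notation L := lop.
Local Notation r := rop.

HB.instance Definition _ i := GRing.isLinear.Build R M M *:%R (lop i)
  (lmul_linear (e i)).
HB.instance Definition _ i := GRing.isLinear.Build R M M *:%R (rop i)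
  (rmul_linear (e i)).

Lemma lopZ i a x : L i (a *: x) = a *: L i x. Proof. exact: linearZ. Qed.

Lemma lopN i x : L i (- x) = - L i x. Proof. exact: linearN. Qed.

Lemma lopD i x y : L i (x + y) = L i x + L i y. Proof. exact: linearD. Qed.

Lemma lopB i x y : L i (x - y) = L i x - L i y. Proof. exact: linearB. Qed.

Lemma lop0 x : L 0 x = x.
Proof. by rewrite /lop -oct_oneE (lact1 (obimod_left (obimoduleP M))). Qed.

Lemma lop_sq i x : (0 < i < 8)%N -> L i (L i x) = - x.
Proof.
move=> hi; rewrite /lop (lact_alt (obimod_left (obimoduleP M))).
by rewrite unit_octMM // lmulNl -/(lop 0 _) lop0.
Qed.

Lemma lop_anti i j x : (0 < i < 8)%N -> (0 < j < 8)%N -> i != j ->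
  L i (L j x) = - L j (L i x).
Proof.
move=> hi hj ij; apply/eqP; rewrite -addr_eq0 lmul_anti.
have [k [|] /(fano_mul R) [-> ->]] := fano_total hi hj ij.
  by rewrite subrr -(subrr 0) lmulDl lmulNl subrr.
by rewrite addNr -(subrr 0) lmulDl lmulNl subrr.
Qed.

Lemma lop_inj i : (0 < i < 8)%N -> injective (L i).
Proof. by move=> hi x y /(congr1 (L i)); rewrite !lop_sq // => /oppr_inj. Qed.

(** The operator T of the line t. The sign makes it the identity on
    associative elements, since e_a (e_b e_c) = -1. *)
Definition line_op (t : nat * nat * nat) x : M :=
  - L t.1.1 (L t.1.2 (L t.2 x)).
Local Notation T := line_op.

Lemma line_op_linear t : linear (T t).
Proof. by move=> a x y; rewrite /line_op !linearP. Qed.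
HB.instance Definition _ t := GRing.isLinear.Build R M M *:%R (line_op t)
  (line_op_linear t).

Definition off_line (n : nat) (t : nat * nat * nat) :=
  n \notin [:: t.1.1; t.1.2; t.2].

(** Moving [L n] across three anticommuting factors costs a sign for each
    factor other than [L n] itself: two signs on the line, three off it. *)
Lemma line_op_lop t n x : t \in fano_cyclic -> (0 < n < 8)%N ->
  T t (L n x) = (-1) ^+ (off_line n t) *: L n (T t x).
Proof.
case: t => [[a b] c] /fano_cyclicP/and5P[ha hb hc + _] hn.
rewrite /off_line /= !inE !negb_or => /and3P[/andP[ab ac] bc _].
have sw m y : (0 < m < 8)%N -> L m (L n y) = (-1) ^+ (n != m) *: L n (L m y).
  move=> hm; case: eqVneq => [->|nm]; first by rewrite scale1r.
  by rewrite scaleN1r lop_anti // eq_sym.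
rewrite /line_op /= (sw c) // lopZ (sw b) // !lopZ (sw a) // !scalerA.
rewrite -scalerN -lopN; congr (_ *: _).
case: (eqVneq n a) => [->|_]; first by rewrite ab ac /= mulr1 mulrN1 opprK.
case: (eqVneq n b) => [->|_]; first by rewrite bc /= mulr1 mulrN1 opprK.
by case: (eqVneq n c) => _ /=; rewrite !(mulr1, mulrN1, mul1r, opprK).
Qed.

Lemma line_op_on t n x : t \in fano_cyclic -> (0 < n < 8)%N ->
  ~~ off_line n t -> T t (L n x) = L n (T t x).
Proof. by move=> ht hn /negPf no; rewrite line_op_lop // no scale1r. Qed.

Lemma line_op_off t n x : t \in fano_cyclic -> (0 < n < 8)%N ->
  off_line n t -> T t (L n x) = - L n (T t x).
Proof. by move=> ht hn no; rewrite line_op_lop // no scaleN1r. Qed.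

Lemma line_opN t x : T t (- x) = - T t x. Proof. exact: linearN. Qed.

Lemma line_opD t x y : T t (x + y) = T t x + T t y.
Proof. exact: linearD. Qed.

Lemma line_opZ t a x : T t (a *: x) = a *: T t x.
Proof. exact: linearZ. Qed.

Lemma line_op_rot a b c x : (a, b, c) \in fano_cyclic ->
  T (b, c, a) x = T (a, b, c) x.
Proof.
move=> /fano_cyclicP/and5P[ha hb hc + _].
rewrite /= !inE negb_or => /and3P[/andP[ab ac] bc _].
rewrite /line_op /= (lop_anti _ hc ha) 1?eq_sym // lopN.
by rewrite (lop_anti _ hb ha) 1?eq_sym // opprK.
Qed.

Lemma line_op_rev a b c x : (a, b, c) \in fano_cyclic ->
  T (a, b, c) x = L c (L b (L a x)).
Proof.
move=> ht; rewrite -line_op_rot //; have := fano_cyclicP ht.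
move=> /and5P[ha hb hc + _].
rewrite /= !inE negb_or => /and3P[/andP[ab ac] bc _].
by rewrite /line_op /= lop_anti // opprK.
Qed.

Lemma line_op_sq t x : t \in fano_cyclic -> T t (T t x) = x.
Proof.
case: t => [[a b] c] ht; have /and5P[ha hb hc _ _] := fano_cyclicP ht.
by rewrite (line_op_rev x) // /line_op /= !(lop_sq, lopN) // !opprK.
Qed.

(** Distinct lines meet in one point, so exactly two of the points of t are
    off s and the two signs of [line_op_lop] cancel; if s and t are the same
    line, no sign occurs. *)
Lemma line_opC s t x : s \in fano_cyclic -> t \in fano_cyclic ->
  T s (T t x) = T t (T s x).
Proof.
move=> hs ht.
have /allP/(_ s hs)/allP/(_ t ht) : all (fun s => all (fun t =>
  ~~ (off_line t.1.1 s (+) off_line t.1.2 s (+) off_line t.2 s))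
  fano_cyclic) fano_cyclic by [].
have : fano_spec t := fano_cyclicP ht.
case: t {ht} => [[a b] c] /and5P[ha hb hc _ _] /= sgn.
have E y : T (a, b, c) y = - L a (L b (L c y)) by [].
rewrite !E line_opN !line_op_lop // !lopZ !scalerA; move: sgn.
by case: (off_line a s); case: (off_line b s); case: (off_line c s) => // _;
  rewrite !(expr0, expr1, mulN1r, mulr1, mul1r, opprK, scale1r).
Qed.

(** Through this equality, the commutator of a left with a right
    multiplication is expressed by left multiplications alone. *)
Lemma assoc_lm p q x :
  assoc_l (@lmul R M) p q x = assoc_m (@lmul R M) (@rmul R M) q x p.
Proof. by rewrite (assoc_lr (obimoduleP M)) (assoc_rm (obimoduleP M)). Qed.

Lemma assoc_l_anti p q x :
  assoc_l (@lmul R M) p q x = - assoc_l (@lmul R M) q p x.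
Proof.
have h0 := lmul_anti p q x; rewrite lmulDl in h0.
by rewrite /assoc_l; zmod_from h0.
Qed.

Lemma assoc_m_anti p q x : assoc_m (@lmul R M) (@rmul R M) p x q =
  - assoc_l (@lmul R M) p q x.
Proof. by rewrite -assoc_lm assoc_l_anti. Qed.

Lemma ropN i x : r i (- x) = - r i x. Proof. exact: linearN. Qed.

Lemma ropB i x y : r i (x - y) = r i x - r i y. Proof. exact: linearB. Qed.

Lemma rop_lop a b x : r a (L b x) =
  L b (r a x) + (lmul (oct_mul (e a) (e b)) x - L a (L b x)).
Proof. by rewrite -/(assoc_l _ _ _ _) assoc_lm addrC subrK. Qed.

Lemma rop_lop_same a x : (0 < a < 8)%N -> r a (L a x) = L a (r a x).
Proof.
move=> ha; rewrite rop_lop unit_octMM // lop_sq // lmulNl -/(lop 0 x) lop0.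
by rewrite subrr addr0.
Qed.

Lemma rop_sq a x : (0 < a < 8)%N -> r a (r a x) = - x.
Proof.
move=> ha; have := assoc_lr (obimoduleP M) (e a) (e a) x.
rewrite /assoc_l (lact_alt (obimod_left (obimoduleP M))) subrr => /esym/eqP.
rewrite subr_eq0 => /eqP; rewrite -[LHS]/(r a (r a x)) => ->.
rewrite unit_octMM //; have := rmul_linearr x (-1) (e 0) 0.
rewrite addr0 !scaleN1r -oct_oneE (ract1 (obimoduleP M)) => ->.
have := rmul_linearr x 1 0 0; rewrite !scale1r addr0.
by rewrite -{1}[rmul x 0]addr0 => /addrI<-; rewrite addr0.
Qed.

(** * Right multiplication by a basis element *)

Section Point.
Variables (a b c : nat).
Hypothesis ht : (a, b, c) \in fano_cyclic.
Local Notation t := (a, b, c).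

Let ha : (0 < a < 8)%N. Proof. by case/and5P: (fano_cyclicP ht). Qed.
Let hb : (0 < b < 8)%N. Proof. by case/and5P: (fano_cyclicP ht). Qed.
Let hc : (0 < c < 8)%N. Proof. by case/and5P: (fano_cyclicP ht). Qed.
Let abc : [/\ a != b, a != c & b != c].
Proof.
case/and5P: (fano_cyclicP ht) => _ _ _ + _.
by rewrite /= !inE !negb_or => /and3P[/andP[-> ->] ->].
Qed.

(** Conjugating the right multiplication by e_a with [L b] subtracts
    L_a (T - 1) from it; the same formula holds for [L c]. *)
Lemma rop_lop2 x : r a (L b x) = L b (r a x - L a (T t x - x)).
Proof.
have [ab ac bc] := abc.
rewrite rop_lop (fano_mul R ht).1 !lopB -/(lop c x); congr (_ + _).
rewrite /line_op /= lopN lop_sq // opprK opprB addrC; congr (_ + _).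
  by rewrite lop_anti // opprK.
by rewrite lop_sq // opprK.
Qed.

Lemma rop_lop3 x : r a (L c x) = L c (r a x - L a (T t x - x)).
Proof.
have [ab ac bc] := abc.
have hca := fano_rot (fano_rot ht).
rewrite rop_lop (fano_mul R hca).2 !lopB lmulNl -/(lop b x); congr (_ + _).
rewrite /line_op /= lopN lop_sq // opprK opprB addrC; congr (_ + _).
  by rewrite lop_anti // opprK.
by rewrite (lop_anti x) // lopN lop_sq // opprK.
Qed.

(** The corrections coming from [L b] and [L c] cancel. *)
Lemma rop_line x : r a (T t x) = T t (r a x).
Proof.
rewrite /line_op /= ropN rop_lop_same // rop_lop2 rop_lop3.
congr (- L a (L b _)).
rewrite lopB !line_op_on // ?/off_line ?inE ?eqxx ?orbT //.
have [ab ac bc] := abc.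
rewrite -[_ - L c x]lopB (lop_anti _ ha hc) // opprK.
by rewrite subrK.
Qed.

(** Twice the Jordan product with e_a. *)
Definition sym_op x : M := r a x + L a x.
Local Notation U := sym_op.

(** Let R be the right multiplication by e_a and D = L_a (T - 1). Since R -
    D is conjugate to R, its square is -1 as well. As R commutes with D and
    D D = 2 (T - 1), this leaves R D = T - 1, that is, (R + L_a)(T - 1) = 0. *)
Lemma sym_op_line x : U (T t x) = U x.
Proof.
pose D z := L a (T t z - z); set w := T t x - x.
have DB u v : D (u - v) = D u - D v.
  by rewrite /D !(line_opD, line_opN, lopD, lopN); zmod.
have conjD : r a (r a x - D x) - D (r a x - D x) = - x.
  by apply: (lop_inj hb); rewrite -!rop_lop2 rop_sq // lopN.
have Dr : D (r a x) = r a (D x).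
  by rewrite /D -rop_line -ropB rop_lop_same.
have DD : D (D x) = w + w.
  rewrite /D line_op_on // ?/off_line ?inE ?eqxx // -lopB lop_sq //.
  by rewrite line_opD line_opN line_op_sq // /w; zmod.
have rDx : r a (D x) = w.
  apply: (@addrr_inj R); rewrite -DD.
  by move: conjD; rewrite ropB rop_sq // DB Dr => h0; zmod_from h0.
have rw : r a w = - L a w.
  by apply: (lop_inj ha); rewrite -rop_lop_same // rDx lopN lop_sq // opprK.
move: rw; rewrite /w ropB lopB => h0; rewrite /sym_op; zmod_from h0.
Qed.

End Point.
Arguments sym_op : clear implicits.

(** * Lines through a common point *)

Section Concurrent.
Variables (a b c d f : nat).
Hypotheses (ht1 : (a, b, c) \in fano_cyclic) (ht2 : (a, d, f) \in fano_cyclic).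
Hypothesis hbt2 : off_line b (a, d, f).
Local Notation t1 := (a, b, c).
Local Notation t2 := (a, d, f).
Local Notation U := (sym_op a).
Let ha : (0 < a < 8)%N. Proof. by case/and5P: (fano_cyclicP ht1). Qed.
Let hb : (0 < b < 8)%N. Proof. by case/and5P: (fano_cyclicP ht1). Qed.

(** Conjugating the relation U T2 = U by [L b], where b is on t1 but not on
    t2, turns T2 into - T2 and U into U - L_a (1 + T1). *)
Lemma sym_opE y :
  U y + U y = L a (y + T t1 y + T t2 y + T t1 (T t2 y)).
Proof.
have ab : a != b by move: hbt2; rewrite /off_line !inE eq_sym; case: (a == b).
have UL z : U (L b z) = L b (U z - L a (z + T t1 z)).
  rewrite /sym_op (rop_lop2 ht1) (lop_anti z ha hb ab).
  by rewrite !(lopD, lopN); zmod.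
have := sym_op_line ht2 (L b y); rewrite (line_op_off y ht2 hb hbt2).
have UN z : U (- z) = - U z by rewrite /sym_op ropN lopN; zmod.
rewrite -lopN !UL UN (sym_op_line ht2) => /(lop_inj hb).
rewrite !(line_opN, lopD, lopN).
by move=> h0; zmod_from h0.
Qed.

End Concurrent.

(** Comparing [sym_opE] for the pairs (T1, T2) and (T1, T3) gives T2 + T1 T2
    = T3 + T1 T3. Conjugation by [L d] changes the signs of T1 and T3,
    giving T2 - T1 T2 = - T3 + T1 T3; the sum of the two is 2 T2 = 2 T1 T3. *)
Lemma concurrent_lines (a b c d f g h : nat) x :
  (a, b, c) \in fano_cyclic -> (a, d, f) \in fano_cyclic ->
  (a, g, h) \in fano_cyclic -> off_line b (a, d, f) -> off_line b (a, g, h) ->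
  off_line d (a, b, c) -> off_line d (a, g, h) ->
  T (a, b, c) (T (a, g, h) x) = T (a, d, f) x.
Proof.
move=> h1 h2 h3 b2 b3 d1 d3; have /and5P[ha _ _ _ _] := fano_cyclicP h1.
have /and5P[_ hd _ _ _] := fano_cyclicP h2.
have E y : T (a, d, f) y + T (a, b, c) (T (a, d, f) y) =
           T (a, g, h) y + T (a, b, c) (T (a, g, h) y).
  have := sym_opE h1 h2 b2 y; rewrite (sym_opE h1 h3 b3 y) => /(lop_inj ha).
  by move=> h0; zmod_from h0.
have d2 : ~~ off_line d (a, d, f) by rewrite /off_line !inE eqxx orbT.
have Td y : [/\ T (a, b, c) (L d y) = - L d (T (a, b, c) y),
    T (a, d, f) (L d y) = L d (T (a, d, f) y) &
    T (a, g, h) (L d y) = - L d (T (a, g, h) y)].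
  by rewrite line_op_off // line_op_on // line_op_off.
have Ed : T (a, d, f) x - T (a, b, c) (T (a, d, f) x) =
          T (a, b, c) (T (a, g, h) x) - T (a, g, h) x.
  apply: (lop_inj hd); have := E (L d x); have [_ -> ->] := Td x.
  rewrite line_opN; have [-> _ _] := Td (T (a, d, f) x).
  have [-> _ _] := Td (T (a, g, h) x); rewrite !(lopD, lopN).
  by move=> h0; zmod_from h0.
apply: (@addrr_inj R); have := congr2 +%R (E x) Ed.
by move=> h0; zmod_from h0.
Qed.

End Clifford.

(** * The real part *)

Section RealPart.
Set Implicit Arguments.
Unset Strict Implicit.
Unset Printing Implicit Defensive.
Variables (R : realType) (M : obimodule R).
Implicit Types (x y : M) (p q : octonion R).
Local Notation e := (unit_oct R).
Local Notation L := (@lop R M).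
Local Notation r := (@rop R M).
Local Notation T := (@line_op R M).

Definition line_sym t x : M := x + T t x.
Local Notation H := line_sym.

Lemma line_sym_linear t : linear (H t).
Proof. by move=> a x y; rewrite /line_sym line_opD line_opZ scalerDr; zmod. Qed.
HB.instance Definition _ t := GRing.isLinear.Build R M M *:%R (line_sym t)
  (line_sym_linear t).

(** Averaging over the group generated by the operators of the three lines,
    which generate all seven by [concurrent_lines]. *)
Definition re x : M := 8^-1 *: H (1,2,3)%N (H (1,4,5)%N (H (2,4,6)%N x)).

Lemma re_linear : linear re.
Proof. by move=> a x y; rewrite /re !linearP. Qed.
HB.instance Definition _ := GRing.isLinear.Build R M M *:%R re re_linear.
Lemma reD x y : re (x + y) = re x + re y. Proof. exact: linearD. Qed.

Lemma reB x y : re (x - y) = re x - re y. Proof. exact: linearB. Qed.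

Lemma reN x : re (- x) = - re x. Proof. exact: linearN. Qed.

Lemma line_op_sym s t x : s \in fano_cyclic -> t \in fano_cyclic ->
  T s (H t x) = H t (T s x).
Proof. by move=> hs ht; rewrite /line_sym line_opD line_opC. Qed.

Lemma line_op_re t x : t \in fano_cyclic -> T t (re x) = re (T t x).
Proof. by move=> ht; rewrite /re line_opZ !line_op_sym. Qed.

(** For a generator T this is (1 + T) T = 1 + T; the other lines are
    products of generators, found by going through the points 1, 2, 4 and 3
    in turn. *)
Lemma re_line_op t x : t \in fano_cyclic -> re (T t x) = re x.
Proof.
have Hid s y : s \in fano_cyclic -> T s (H s y) = H s y.
  by move=> hs; rewrite /line_sym line_opD line_op_sq // addrC.
have E123 y : re (T (1,2,3)%N y) = re y.
  by rewrite -line_op_re // /re line_opZ Hid.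
have E145 y : re (T (1,4,5)%N y) = re y.
  by rewrite -line_op_re // /re line_opZ line_op_sym // Hid.
have E246 y : re (T (2,4,6)%N y) = re y.
  by rewrite -line_op_re // /re line_opZ !line_op_sym // -line_op_sym // Hid.
have E176 y : re (T (1,7,6)%N y) = re y.
  by rewrite -(@concurrent_lines _ _ 1 2 3 _ _ 4 5) // E123.
have E257 y : re (T (2,5,7)%N y) = re y.
  rewrite -(@concurrent_lines _ _ 2 3 1 _ _ 4 6) //.
  by rewrite line_op_rot // E123.
have E347 y : re (T (3,4,7)%N y) = re y.
  rewrite -line_op_rot // -(@concurrent_lines _ _ 4 5 1 _ _ 6 2) //.
  by rewrite line_op_rot // E145 line_op_rot.
have E365 y : re (T (3,6,5)%N y) = re y.
  rewrite -(@concurrent_lines _ _ 3 1 2 _ _ 4 7) //.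
  by rewrite -line_op_rot // E123.
have E s y : s \in fano -> re (T s y) = re y.
  by rewrite !inE => /or4P[|||/or4P[]] /eqP->.
rewrite /fano_cyclic !mem_cat => /or3P[/E //|/mapP|/mapP] [[[a b] c] hs ->] /=.
  by rewrite line_op_rot ?E // /fano_cyclic mem_cat hs.
have hs' : (a, b, c) \in fano_cyclic by rewrite /fano_cyclic mem_cat hs.
by rewrite -(line_op_rot _ (fano_rot (fano_rot hs'))) E.
Qed.

(** Hence e_a (e_b x) and (e_a e_b) x differ by T only. *)
Lemma lop_line a b c x : (a, b, c) \in fano_cyclic ->
  L a (L b x) = T (a, b, c) (L c x).
Proof.
move=> ht; have /and5P[_ _ hc _ _] := fano_cyclicP ht.
by rewrite /line_op /= lop_sq // !lopN opprK.
Qed.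

(** Used twice: with phi = [re] for arbitrary y, and with phi the identity
    for y fixed by all the T's. *)
Lemma assoc_of_line_op (V : lmodType R) (phi : {linear M -> V}) y :
    (forall t n, t \in fano_cyclic -> (0 < n < 8)%N -> ~~ off_line n t ->
       phi (T t (L n y)) = phi (L n y)) ->
  forall p q, phi (lmul (oct_mul p q) y) = phi (lmul p (lmul q y)).
Proof.
move=> Tphi; apply: oct_ext2.
- by move=> q a p1 p2; rewrite oct_mul_linearl lmul_linearl linearP.
- by move=> p a q1 q2; rewrite oct_mul_linearr lmul_linearl linearP.
- by move=> q a p1 p2; rewrite lmul_linearl linearP.
- by move=> p a q1 q2; rewrite lmul_linearl !linearP.
move=> i j hi hj; rewrite -!/(lop _ _).
have key a b c : (a, b, c) \in fano_cyclic -> phi (L a (L b y)) = phi (L c y).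
  move=> ht; have /and5P[_ _ hc _ _] := fano_cyclicP ht.
  by rewrite (lop_line _ ht) Tphi // /off_line !inE eqxx !orbT.
have [->|i0] := posnP i; first by rewrite unit_oct1M // lop0.
have [->|j0] := posnP j; first by rewrite unit_octM1 // lop0.
have hi' : (0 < i < 8)%N by rewrite i0.
have hj' : (0 < j < 8)%N by rewrite j0.
have [<-|ij] := eqVneq i j.
  by rewrite unit_octMM // lmulNl -/(lop 0 y) lop0 lop_sq.
have [k [|] hk] := fano_total hi' hj' ij.
  by rewrite (fano_mul R hk).1 (key _ _ _ hk).
rewrite (fano_mul R hk).2 lmulNl (lop_anti y hi') // !linearN /=.
by rewrite (key _ _ _ hk).
Qed.

Lemma re_assoc p q x : re (lmul (oct_mul p q) x) = re (lmul p (lmul q x)).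
Proof. by apply: (@assoc_of_line_op M re) => t n ht _ _; apply: re_line_op. Qed.

Lemma associative_re x : associative_elt (re x).
Proof.
move=> p q; rewrite /assoc_l; apply/eqP; rewrite subr_eq0; apply/eqP.
apply: (@assoc_of_line_op M idfun) => t n ht hn no /=.
by rewrite line_op_on // line_op_re // re_line_op.
Qed.

Lemma line_op_associative t a : t \in fano_cyclic -> associative_elt a ->
  T t a = a.
Proof.
case: t => [[i j] k] ht ass; have /and5P[_ _ hk _ _] := fano_cyclicP ht.
apply: (lop_inj hk); rewrite -line_op_on // ?/off_line ?inE ?eqxx ?orbT //.
have /eqP := ass (e i) (e j); rewrite /assoc_l (fano_mul R ht).1 subr_eq0.
by rewrite -lop_line // => /eqP.
Qed.

Lemma re_associative a : associative_elt a -> re a = a.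
Proof.
move=> ass; rewrite /re /line_sym !(line_opD, line_op_associative) //.
have n8 : (8 : R) != 0 by rewrite pnatr_eq0.
apply: (scalerI n8); rewrite scalerA mulfV // scale1r scaler_nat.
rewrite !mulrS mulr0n; zmod.
Qed.

(** A line avoiding i has T = 1 on a but T = -1 on e_i a. *)
Lemma re_lop_associative i a : (0 < i < 8)%N -> associative_elt a ->
  re (L i a) = 0.
Proof.
move=> hi ass.
have /allP/(_ i) : all (fun i => has (off_line i) fano_cyclic) (iota 1 7) by [].
rewrite mem_iota => /(_ hi)/hasP[t ht off].
apply: (@addrr_inj R); rewrite -{1}(re_line_op _ ht) line_op_off //.
by rewrite linearN /= line_op_associative // addNr addr0.
Qed.

Definition signed_sym (b : bool) t x : M := if b then x - T t x else x + T t x.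

(** Conjugation by [L i] changes the sign of the generators whose lines
    avoid i. *)
Lemma lop_re_lop i x : (0 < i < 8)%N -> L i (re (L i x)) =
  - (8^-1 *: signed_sym (off_line i (1,2,3)%N) (1,2,3)%N
      (signed_sym (off_line i (1,4,5)%N) (1,4,5)%N
        (signed_sym (off_line i (2,4,6)%N) (2,4,6)%N x))).
Proof.
move=> hi; have HL t y : t \in fano_cyclic ->
    H t (L i y) = L i (signed_sym (off_line i t) t y).
  move=> ht; rewrite /line_sym /signed_sym.
  case: ifPn => off; first by rewrite line_op_off // lopB.
  by rewrite line_op_on // lopD.
by rewrite /re !HL // lopZ lop_sq // scalerN.
Qed.

(** The signs on the three generators run through all eight possibilities as
    i varies, so every product of generators other than 1 cancels in the
    sum. *)
Lemma re_decomposition x :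
  x = re x - \sum_(1 <= i < 8) L i (re (L i x)).
Proof.
have n8 : (8 : R) != 0 by rewrite pnatr_eq0.
apply: (scalerI n8); rewrite scalerBr scaler_sumr.
do 7! rewrite [\sum_(_ <= _ < 8) _]big_ltn //.
rewrite [\sum_(8 <= _ < 8) _]big_geq //.
do 7! (rewrite lop_re_lop; last by []).
rewrite !scalerN /re !scalerA mulfV // !scale1r scaler_nat.
rewrite /line_sym /signed_sym /off_line /=.
rewrite !(line_opD, line_opN) !mulrS mulr0n; zmod.
Qed.

(** The decomposition of x exists by [re_decomposition], and applying [re]
    to any such decomposition returns its component of index 0. *)
Lemma Re_re x : Defs.Re x = re x.
Proof.
apply: xget_unique.
  exists (fun i : 'I_8 => if i == ord0 then re x else - re (L i x)).
  split=> //.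
    move=> i; case: eqP => _; first exact: associative_re.
    move=> p q; have := associative_re (L i x) p q.
    by rewrite /assoc_l !lmulN => h0; zmod_from h0.
  rewrite big_ord_recl /= oct_basisE -/(lop 0 _) lop0 {1}[x]re_decomposition.
  congr (_ + _); rewrite -sumrN big_add1 big_mkord.
  by apply: eq_bigr => i _; rewrite oct_basisE -/(lop _ _) lopN.
move=> _ [y [ass -> ->]]; rewrite linear_sum /= big_ord_recl big1 => [|i _].
  by rewrite oct_basisE -/(lop 0 _) lop0 re_associative // addr0.
by rewrite oct_basisE -/(lop _ _) re_lop_associative //= ltnS ltn_ord.
Qed.

Lemma re_lmul_eq0 x : (forall p, re (lmul p x) = 0) -> x = 0.
Proof.
move=> h; have := h (e 0).
rewrite -/(lop 0 x) lop0 {2}[x]re_decomposition => ->.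
by rewrite big1 ?subr0 // => i _; rewrite h linear0.
Qed.

(** For p = e_a, apply [re] to [sym_opE]: the operators of the lines through
    a commute with [L a] and are absorbed by [re], so that 2 Re (x e_a + e_a
    x) = 4 Re (e_a x). *)
Lemma re_mulC p x : re (rmul x p) = re (lmul p x).
Proof.
move: p; apply: oct_ext => [a p q|a p q|a ha].
- by rewrite rmul_linearr linearP.
- by rewrite lmul_linearl linearP.
rewrite -/(rop a x) -/(lop a x).
have [->|a0] := posnP a.
  by rewrite lop0 /rop -oct_oneE (ract1 (obimoduleP M)).
have /allP/(_ a) : all (fun a => has (fun t => has (fun s =>
   [&& t.1.1 == a, s.1.1 == a & off_line t.1.2 s]) fano_cyclic) fano_cyclic)
   (iota 1 7) by [].
rewrite mem_iota a0 => /(_ ha)/hasP[[[a1 b] c] ht /hasP[[[a2 d] f] hs]].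
case/and3P => /= /eqP ? /eqP ? off; subst a1 a2.
have reT t y : t \in fano_cyclic -> ~~ off_line a t ->
    re (L a (T t y)) = re (L a y).
  by move=> h h'; rewrite -line_op_on ?a0 // re_line_op.
have /(congr1 re) := sym_opE ht hs off x; rewrite /sym_op !lopD !linearD /=.
rewrite !reT // ?/off_line ?inE ?eqxx ?orbT // => h0.
apply: (@addrr_inj R); zmod_from h0.
Qed.

End RealPart.

(** * Left para-linear maps *)

Section HomBimodule.
Set Implicit Arguments.
Unset Strict Implicit.
Unset Printing Implicit Defensive.
Variables (R : realType) (M N : obimodule R).
Implicit Types (x : M) (p q : octonion R).

Lemma left_paralinearP (f : M -> N) : left_paralinear f <->
  linear f /\ forall p x, re (f (lmul p x)) = re (lmul p (f x)).
Proof.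
split=> -[lf hf]; split=> // p x; have := hf p x;
  rewrite Re_re /defect linearB /=.
  by move=> /eqP; rewrite subr_eq0 => /eqP.
by move=> ->; rewrite subrr.
Qed.

(** f x is determined by the values Re (p f(x)) = Re f(p x). *)
Lemma left_paralinear_eq (f g : M -> N) : left_paralinear f ->
  left_paralinear g -> (forall x, re (f x) = re (g x)) -> f = g.
Proof.
move=> /left_paralinearP[_ hf] /left_paralinearP[_ hg] fg; apply/funext => x.
apply/eqP; rewrite -subr_eq0; apply/eqP/re_lmul_eq0 => p.
by rewrite !linearB /= -hf -hg fg subrr.
Qed.

Lemma left_paralinear_linear (a : R) (f g : M -> N) : left_paralinear f ->
  left_paralinear g -> left_paralinear (fun x => a *: f x + g x).
Proof.
move=> /left_paralinearP[lf hf] /left_paralinearP[lg hg].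
apply/left_paralinearP; split=> [b x y|p x]; last by rewrite !linearP /= hf hg.
by rewrite lf lg !scalerDr !scalerA [b * a]mulrC addrACA.
Qed.

Lemma homLO_submod : GRing.submod_closed (homLO M N).
Proof.
split=> [|a f g]; rewrite !inE; last exact: left_paralinear_linear.
apply/left_paralinearP; split=> [b x y|p x] /=.
  by rewrite scaler0 addr0.
have E y : (0 : M -> N) y = 0 by [].
by rewrite !E [lmul _ 0]linear0.
Qed.

Local Notation HomLO := (HomLO homLO_submod).
Implicit Types f g : HomLO.

Lemma homLO_paralinear f : left_paralinear f.
Proof. by apply/asboolP; have := homLO_funP f; rewrite inE. Qed.

Lemma homLO_linear f : linear f.
Proof. by have [] := homLO_paralinear f. Qed.
HB.instance Definition _ f := GRing.isLinear.Build R M N *:%R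
  (homLO_fun f) (homLO_linear f).

Lemma re_homLO f p x : re (lmul p (f x)) = re (f (lmul p x)).
Proof. by have /left_paralinearP[] := homLO_paralinear f. Qed.

Lemma homLO_eq f g : (forall x, re (f x) = re (g x)) -> f = g.
Proof.
by move=> fg; apply/val_inj/left_paralinear_eq => //; apply: homLO_paralinear.
Qed.

Lemma homLO_linearE a f g x : (a *: f + g) x = a *: f x + g x.
Proof. by []. Qed.

Lemma homLOD f x y : f (x + y) = f x + f y. Proof. exact: linearD. Qed.

Lemma homLOB f x y : f (x - y) = f x - f y. Proof. exact: linearB. Qed.

Definition hom_right f p x : N := rmul (f x) p - defect p x f.
Definition hom_left p f x : N := f (rmul x p) + defect p x f.

Lemma re_defect f p x : re (defect p x f) = 0.
Proof. by rewrite /defect linearB /= re_homLO subrr. Qed.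

(** With the next lemma: on real parts, the actions on maps are the
    transposes of the opposite actions on M. *)
Lemma re_hom_right f p x : re (hom_right f p x) = re (f (lmul p x)).
Proof. by rewrite /hom_right linearB /= re_defect subr0 re_mulC re_homLO. Qed.

Lemma re_hom_left f p x : re (hom_left p f x) = re (f (rmul x p)).
Proof. by rewrite /hom_left linearD /= re_defect addr0. Qed.

(** Every term of Re (p h(x)), for h = f.q, can be moved inside f; it then
    remains to see that (q p) x - p (q x) + (p q) x = q (p x), which is
    [lmul_anti]. *)
Lemma hom_right_paralinear f q : left_paralinear (hom_right f q).
Proof.
apply/left_paralinearP; split=> [a x y|p x].
  rewrite /hom_right /defect lmul_linear !homLO_linear rmul_linear lmul_linear.
  by rewrite !(scalerDr, scalerN); zmod.
rewrite re_hom_right.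
(* Re vanishes on the associator (p y) q - p (y q), and Re (y q) = Re (q y). *)
have swap : re (lmul p (rmul (f x) q)) = re (f (lmul (oct_mul q p) x)).
  rewrite -re_homLO re_assoc -(re_mulC q).
  have /(congr1 (@re R N)) := assoc_m_anti p q (f x).
  by rewrite /assoc_m /assoc_l reN !reB re_assoc => h0; zmod_from h0.
have /(congr1 (fun y => re (f y))) := lmul_anti p q x.
rewrite lmulDl !homLOD !reD /hom_right /defect !(lmulD, lmulN, reD, reN).
rewrite swap -re_assoc !re_homLO.
by move=> h0; zmod_from h0.
Qed.

(** As above; the identity needed is (p x) q - p (x q) = p (q x) - (p q) x. *)
Lemma hom_left_paralinear f q : left_paralinear (hom_left q f).
Proof.
apply/left_paralinearP; split=> [a x y|p x].
  rewrite /hom_left /defect lmul_linear rmul_linear !homLO_linear lmul_linear.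
  by rewrite !(scalerDr, scalerN); zmod.
rewrite re_hom_left.
have /(congr1 (fun y => re (f y))) := assoc_m_anti p q x.
rewrite /assoc_m /assoc_l opprB !homLOB !reB.
rewrite /hom_left /defect !(lmulD, lmulN, reD, reN) -re_assoc !re_homLO.
by move=> h0; zmod_from h0.
Qed.

Definition homLO_left q f : HomLO :=
  MkHomLO homLO_submod (asboolT (hom_left_paralinear f q)).
Definition homLO_right f q : HomLO :=
  MkHomLO homLO_submod (asboolT (hom_right_paralinear f q)).

Lemma re_homLO_left q f x : re (homLO_left q f x) = re (f (rmul x q)).
Proof. exact: re_hom_left. Qed.

Lemma re_homLO_right q f x : re (homLO_right f q x) = re (f (lmul q x)).
Proof. exact: re_hom_right. Qed.

(** By transposition, the left, right and middle associators of f become, up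
    to sign, the right, left and middle associators of x, evaluated under Re
    o f. *)
Lemma homLO_obimodule : is_obimodule homLO_left homLO_right.
Proof.
have subE f g x : (f - g) x = f x - g x by [].
have altM p x := lact_alt (obimod_left (obimoduleP M)) p x.
split; first split.
- move=> f a p q; apply: homLO_eq => x.
  by rewrite homLO_linearE linearP /= !re_homLO_left rmul_linearr !linearP.
- move=> p a f g; apply: homLO_eq => x.
  by rewrite homLO_linearE linearP /= !re_homLO_left homLO_linearE linearP.
- move=> f; apply: homLO_eq => x.
  by rewrite re_homLO_left (ract1 (obimoduleP M)).
- move=> p f; apply: homLO_eq => x; rewrite !re_homLO_left.
  have := assoc_lr (obimoduleP M) p p x.
  rewrite /assoc_l altM subrr => /esym/eqP.
  by rewrite subr_eq0 => /eqP->.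
- move=> p a f g; apply: homLO_eq => x.
  by rewrite homLO_linearE linearP /= !re_homLO_right homLO_linearE linearP.
- move=> f a p q; apply: homLO_eq => x.
  by rewrite homLO_linearE linearP /= !re_homLO_right lmul_linearl !linearP.
- move=> f; apply: homLO_eq => x.
  by rewrite re_homLO_right (lact1 (obimod_left (obimoduleP M))).
- move=> p q f; apply: homLO_eq => x.
  rewrite /assoc_l /assoc_r !subE reB [RHS]reB !(re_homLO_left, re_homLO_right).
  have /(congr1 (fun y => re (f y))) := assoc_lr (obimoduleP M) p q x.
  by rewrite /assoc_l /assoc_r !homLOB !reB => h0; zmod_from h0.
- move=> p q f; apply: homLO_eq => x.
  rewrite /assoc_m /assoc_r !subE reB [RHS]reB !(re_homLO_left, re_homLO_right).
  have /(congr1 (fun y => re (f y))) := assoc_m_anti p q x.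
  by rewrite /assoc_m /assoc_l opprB !homLOB !reB => h0; zmod_from h0.
Qed.

End HomBimodule.

Theorem theorem3p22 (R : realType) (M M' : obimodule R) :
  exists (hS : GRing.submod_closed (homLO M M'))
         (lact : octonion R -> HomLO hS -> HomLO hS)
         (ract : HomLO hS -> octonion R -> HomLO hS),
    [/\ is_obimodule lact ract,
        forall (f : HomLO hS) (r : octonion R) (x : M),
          ract f r x = rmul (f x) r - defect r x f
      & forall (r : octonion R) (f : HomLO hS) (x : M),
          lact r f x = f (rmul x r) + defect r x f].
Proof.
exists (homLO_submod M M'), (@homLO_left R M M'), (@homLO_right R M M').
by split=> //; apply: homLO_obimodule.
Qed.
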